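(* Let $s\in(0,1)$, let $\Omega\subset\mathbb{R}^n$ be an open set and let $E_0\subset\mathbb{R}^n$. Then there exists a set $E\subset\mathbb{R}^n$ which is locally $s$-minimal in $\Omega$ and satisfies $E\setminus\Omega=E_0\setminus\Omega$.
   Context: All sets are Lebesgue measurable and are identified up to sets of measure zero. For disjoint $A,B\subset\mathbb{R}^n$ put $\mathcal{L}_s(A,B)=\int_A\int_B\frac{dx\,dy}{|x-y|^{n+s}}\in[0,\infty]$. The $s$-perimeter of $E\subset\mathbb{R}^n$ in an open set $\Omega\subset\mathbb{R}^n$ is, writing $E^c=\mathbb{R}^n\setminus E$, $$P_s(E,\Omega)=\mathcal{L}_s(E\cap\Omega,E^c\cap\Omega)+\mathcal{L}_s(E\cap\Omega,E^c\setminus\Omega)+\mathcal{L}_s(E\setminus\Omega,E^c\cap\Omega).$$ $E$ is $s$-minimal in $\Omega$ if $P_s(E,\Omega)<\infty$ and $P_s(E,\Omega)\leq P_s(F,\Omega)$ for every $F\subset\mathbb{R}^n$ with $F\setminus\Omega=E\setminus\Omega$. $E$ is locally $s$-minimal in $\Omega$ if it is $s$-minimal in every open set $\Omega'\subset\subset\Omega$, where $A\subset\subset B$ means that $\overline{A}$ is compact and $\overline{A}\subset B$. *)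

(* Defs.v *)
From HB Require Import structures.
From mathcomp Require Import all_boot all_order all_algebra.
From mathcomp Require Import all_classical all_reals all_analysis.

Set Implicit Arguments.
Unset Strict Implicit.
Unset Printing Implicit Defensive.

Import Order.TTheory GRing.Theory Num.Theory.
Import numFieldNormedType.Exports.

Local Open Scope classical_set_scope.
Local Open Scope ring_scope.

(* The n-fold product of the Lebesgue measure of the line, as a set function
   to be used on the product sigma-algebra of n.-tuple R. *)
Fixpoint lebesgue_tuple (R : realType) (n : nat) :
    set (n.-tuple (measurableTypeR R)) -> \bar R :=
  match n with
  | 0 => \d_ [tuple]
  | m.+1 => fun A => (@lebesgue_measure R \x @lebesgue_tuple R m)%E
      [set p | A (cons_tuple p.1 p.2)]
  end.

Section lebesgue_outer.
Context (R : realType) (n : nat).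
Local Open Scope ereal_scope.

Let row_of_tuple (t : n.-tuple R) : 'rV[R]_n := (\row_i tnth t i)%R.

(* Lebesgue outer measure on R^n, transported to row vectors because these
   (and not tuples) carry the topology of R^n. *)
Definition lebesgue_outer (A : set 'rV[R]_n) : \bar R :=
  ((@lebesgue_tuple R n)^*)%mu (row_of_tuple @^-1` A).

Let lebesgue_tuple_ge0 A : 0 <= @lebesgue_tuple R n A.
Proof.
case: n A => [|m] A /=; first exact: measure_ge0.
apply: integral_ge0 => x _ /=.
elim: m {A} (xsection _ _) => [|m IHm] A /=; first exact: measure_ge0.
by apply: integral_ge0 => y _ /=; exact: IHm.
Qed.

Let lebesgue_tuple0 : @lebesgue_tuple R n set0 = 0.
Proof.
elim: n => [|m IHm] /=; first exact: measure0.
rewrite [LHS]integral0_eq// => x _ /=.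
rewrite (_ : xsection _ _ = set0) ?IHm//.
by apply/seteqP; split => // y /=; rewrite /xsection/= inE.
Qed.

Let lebesgue_outer0 : lebesgue_outer set0 = 0.
Proof. by rewrite /lebesgue_outer preimage_set0 mu_ext0. Qed.

Let lebesgue_outer_ge0 A : 0 <= lebesgue_outer A.
Proof. exact: mu_ext_ge0. Qed.

Let le_lebesgue_outer : {homo lebesgue_outer : A B / A `<=` B >-> A <= B}.
Proof. by move=> A B AB; apply: le_mu_ext => t; exact: AB. Qed.

Let lebesgue_outer_sigma_subadditive : sigma_subadditive lebesgue_outer.
Proof.
by move=> F; rewrite /lebesgue_outer preimage_bigcup; exact: mu_ext_sigma_subadditive.
Qed.

HB.instance Definition _ := isOuterMeasure.Build R 'rV[R]_n lebesgue_outer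
  lebesgue_outer0 lebesgue_outer_ge0 le_lebesgue_outer
  lebesgue_outer_sigma_subadditive.

End lebesgue_outer.

(* R^n with the sigma-algebra of Lebesgue (not only Borel) measurable sets. *)
Notation lebesgueType R n := (caratheodory_type (@lebesgue_outer R n)).

Definition lebesgue_rV (R : realType) (n : nat) : set (lebesgueType R n) -> \bar R :=
  @lebesgue_outer R n.

HB.instance Definition _ (R : realType) (n : nat) :=
  isMeasure.Build _ (lebesgueType R n) R (@lebesgue_rV R n)
    (@caratheodory_measure0 _ _ (@lebesgue_outer R n))
    (@caratheodory_measure_ge0 _ _ (@lebesgue_outer R n))
    (@caratheodory_measure_sigma_additive _ _ (@lebesgue_outer R n)).

Definition lebesgue_measurable (R : realType) (n : nat) (A : set 'rV[R]_n) : Prop :=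
  measurable (A : set (lebesgueType R n)).

Definition eq_set_ae (R : realType) (n : nat) (A B : set 'rV[R]_n) : Prop :=
  {ae @lebesgue_rV R n, forall x, A x <-> B x}.

(* The norm of 'rV[R]_n in the library is the sup norm. *)
Definition edist (R : realType) (n : nat) (x y : 'rV[R]_n) : R :=
  Num.sqrt (\sum_(i < n) (x 0 i - y 0 i) ^+ 2).

Definition interaction (R : realType) (n : nat) (s : R) (A B : set 'rV[R]_n) : \bar R :=
  (\int[@lebesgue_rV R n]_(x in A) \int[@lebesgue_rV R n]_(y in B)
     ((edist x y `^ (n%:R + s))^-1)%:E)%E.

Definition s_perimeter (R : realType) (n : nat) (s : R) (E Omega : set 'rV[R]_n) : \bar R :=
  (interaction s (E `&` Omega) (~` E `&` Omega)
   + interaction s (E `&` Omega) (~` E `\` Omega)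
   + interaction s (E `\` Omega) (~` E `&` Omega))%E.

Definition s_minimal (R : realType) (n : nat) (s : R) (Omega E : set 'rV[R]_n) : Prop :=
  (s_perimeter s E Omega < +oo)%E /\
  forall F : set 'rV[R]_n, lebesgue_measurable F ->
    eq_set_ae (F `\` Omega) (E `\` Omega) ->
    (s_perimeter s E Omega <= s_perimeter s F Omega)%E.

Definition compactly_included (R : realType) (n : nat) (A B : set 'rV[R]_n) : Prop :=
  compact (closure A) /\ closure A `<=` B.

Definition locally_s_minimal (R : realType) (n : nat) (s : R) (Omega E : set 'rV[R]_n) : Prop :=
  forall Omega' : set 'rV[R]_n, open Omega' ->
    compactly_included Omega' Omega -> s_minimal s Omega' E.

(* Main.v *)
(** Submodularity, [P (E `|` F) + P (E `&` F) <= P E + P F], replaces the usual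
    compactness argument.  It makes the upper limit of a minimizing sequence
    (with errors [2^-k]) a minimizer in any [V] whose interaction with its
    complement is finite, by Fatou's lemma alone.  Exhaust [Omega] by finite
    unions [V_k] of cubes and prescribe the exterior datum [E0] outside [Omega]
    and everything in [Omega \ V_k]; submodularity again lets the minimizers
    [E_k] be chosen decreasing in [k], and their intersection [E] is minimal in
    each [V_j]: a competitor [F] for [E] is compared with [E_k] through
    [(F `&` V_j) `|` (E_k \ V_j)], and the error this makes is an interaction
    of [V_j] with sets decreasing to the empty set.  Minimality passes to open
    subsets of [V_j], since pairs avoiding the subset contribute equally to
    both perimeters. *)
Require Import Defs.
From HB Require Import structures.
From mathcomp Require Import all_boot all_order all_algebra.
From mathcomp Require Import all_classical all_reals all_analysis.
From mathcomp Require Import measurable_realfun.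
From mathcomp Require Import ring lra.
Import Order.TTheory GRing.Theory Num.Theory.
Import numFieldNormedType.Exports.
Local Open Scope classical_set_scope.
Local Open Scope ring_scope.

Set Implicit Arguments.
Unset Strict Implicit.
Unset Printing Implicit Defensive.

(** * Fatou's lemma for sets *)

Section liminf.
Context d (T : measurableType d) (R : realType) (mu : {measure set T -> \bar R}).
Local Open Scope ereal_scope.

(** The tail intersections increase to the lower limit of [S], so continuity from below bounds its
    measure by any eventual bound [c]. *)
Lemma measure_le_liminf (S : (set T)^nat) (A : set T) (m : nat) (c : \bar R) :
  (forall k, measurable (S k)) -> measurable A ->
  A `<=` \bigcup_i \bigcap_(k in [set k | (i <= k)%N]) S k ->
  (forall k, (m <= k)%N -> mu (S k) <= c) -> mu A <= c.
Proof.
move=> mS mA AS Sc.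
pose U i := \bigcap_(k in [set k | (i <= k)%N]) S k.
have mU i : measurable (U i) by apply: bigcap_measurable => //; exists i => /=.
have mUU : measurable (\bigcup_i U i) by exact: bigcup_measurable.
apply: (@le_trans _ _ (mu (\bigcup_i U i))); first by rewrite le_measure ?inE.
have ndU : {homo U : i j / (i <= j)%N >-> (i <= j)%O}.
  move=> i j ij; apply/subsetPset => x Ux k /= jk.
  by apply: Ux; exact: (leq_trans ij).
have cU := @nondecreasing_cvg_mu _ _ _ mu U mU mUU ndU.
rewrite -(cvg_lim _ cU)//.
apply: lime_le; first exact: (cvgP _ cU).
near=> i; apply: (le_trans _ (Sc i _)); last by near: i; exists m.
by rewrite /= le_measure ?inE// => x; apply => /=.
Unshelve. all: by end_near. Qed.

End liminf.

(** * Perimeter of a measure on pairs: submodularity and existence of minimizers *)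

Section perimeter.
Context d (T : measurableType d) (R : realType).
Variable nu : {measure set (T * T) -> \bar R}.
Local Open Scope ereal_scope.
Implicit Types E F V W : set T.

(** One set of ordered pairs, the disjoint union of the three rectangles of the s-perimeter, so that
    comparing perimeters reduces to inclusions of sets. *)
Definition crossing V E : set (T * T) :=
  (E `*` ~` E) `&` [set z | V z.1 \/ V z.2].

Definition perimeter V E : \bar R := nu (crossing V E).

(** Agreement off [V] is exact here; null sets are dealt with by [perimeter_ae]. *)
Definition minimal V E := forall F, measurable F -> F `\` V = E `\` V ->
  perimeter V E <= perimeter V F.

Lemma measurable_crossing V E :
  measurable V -> measurable E -> measurable (crossing V E).
Proof.
move=> mV mE; apply: measurableI.
  by apply: measurableX => //; exact: measurableC.
rewrite (_ : [set _ | _] = (V `*` setT) `|` (setT `*` V)); last first.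
  by apply/seteqP; split => -[x y]/=; tauto.
by apply: measurableU; exact: measurableX.
Qed.

(** A pair crossing the union or the intersection crosses [E] or [F], and a pair crossing both of
    them crosses both [E] and [F]. Inclusion-exclusion for [nu], valid with infinite values, turns
    this into the inequality. *)
Lemma perimeter_setUI V E F : measurable V -> measurable E -> measurable F ->
  perimeter V (E `|` F) + perimeter V (E `&` F) <= perimeter V E + perimeter V F.
Proof.
move=> mV mE mF.
have mm := measurable_crossing mV.
have UI A B : measurable A -> measurable B ->
    nu A + nu B = nu (A `|` B) + nu (A `&` B).
  move=> mA mB; rewrite -{1}(setUIDK A B) setUC measureU//; last 3 first.
  - exact: measurableD.
  - exact: measurableI.
  - by apply/seteqP; split => // x [] [? ?] [].
  rewrite -addeA [X in _ + X]addeC addeA; congr (_ + _).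
  rewrite -measureU ?setDUl//; last 2 first.
  - exact: measurableD.
  - by apply/seteqP; split => // x [] [].
  by congr (nu _); apply/seteqP; split => x /=; have [] := pselect (B x); tauto.
have mU := measurableU _ _ mE mF; have mI := measurableI _ _ mE mF.
rewrite /perimeter UI; [|exact: mm..].
rewrite (UI (crossing V E)); [|exact: mm..].
apply: leeD; rewrite le_measure ?inE.
- by [].
- by apply: measurableU; exact: mm.
- by apply: measurableU; exact: mm.
- move=> [x y]; rewrite /crossing/=.
  by have [] := pselect (F y); have [] := pselect (E y); tauto.
- by [].
- by apply: measurableI; exact: mm.
- by apply: measurableI; exact: mm.
- by move=> [x y]; rewrite /crossing/=; tauto.
Qed.

(** Lower semicontinuity: a pair crossing [E] crosses every [E_ k] from some index on. *)
Lemma perimeter_le_lim V E (E_ : (set T)^nat) (m : nat) (c : \bar R) :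
  measurable V -> measurable E -> (forall k, measurable (E_ k)) ->
  (forall x, exists i, forall k, (i <= k)%N -> (E_ k x <-> E x)) ->
  (forall k, (m <= k)%N -> perimeter V (E_ k) <= c) ->
  perimeter V E <= c.
Proof.
move=> mV mE mE_ cE; apply: measure_le_liminf.
- by move=> k; exact: measurable_crossing.
- exact: measurable_crossing.
- move=> [x y] [[/= Ex Ey] Vxy].
  have [i xi] := cE x; have [j yj] := cE y.
  exists (maxn i j) => // k /=; rewrite geq_max => /andP[ik jk].
  by split => //=; split => /=; [exact/(xi _ ik)|move/(yj _ jk)].
Qed.

(* Pairs that meet W but not V contribute equally to both sets. *)
Lemma perimeter_local V W E F : measurable V -> measurable W ->
  measurable E -> measurable F -> V `<=` W -> E `\` V = F `\` V ->
  exists r, [/\ 0 <= r, perimeter W E = perimeter V E + r &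
    perimeter W F = perimeter V F + r].
Proof.
move=> mV mW mE mF VW EF.
have EFV x : ~ V x -> E x <-> F x.
  by move=> Vx; move/seteqP: EF => [/(_ x) + /(_ x)] => /=; tauto.
have split_crossing G : measurable G ->
    perimeter W G = perimeter V G + nu (crossing W G `\` crossing V G).
  move=> mG; rewrite /perimeter -measureU//; first last.
  - by apply/seteqP; split => // x [? []].
  - by apply: measurableD; exact: measurable_crossing.
  - exact: measurable_crossing.
  congr (nu _); apply/seteqP; split => [z Wz|z [Vz|[]//]].
    by have [|] := pselect (crossing V G z); [left|right].
  by case: Vz => Gz [] Vz; split => //=; [left|right]; exact: VW.
exists (nu (crossing W E `\` crossing V E)); split => //.
- exact: split_crossing.
- rewrite (split_crossing _ mF); congr (_ + nu _).
  apply/seteqP; split => -[x y]; rewrite /crossing/=;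
  have := EFV x; have := EFV y; tauto.
Qed.

(** Removing [V] from [A] leaves only crossing pairs that go from outside [V] into [V]. This is the
    competitor that makes the infimum finite. *)
Lemma perimeter_setD_lty V A : measurable V -> measurable A ->
  nu (~` V `*` V) < +oo -> perimeter V (A `\` V) < +oo.
Proof.
move=> mV mA; apply: le_lt_trans; rewrite le_measure ?inE//.
- by apply: measurable_crossing => //; exact: measurableD.
- by apply: measurableX => //; exact: measurableC.
- by move=> [x y]; rewrite /crossing/=; tauto.
Qed.

Lemma minimal_perimeter_lty V E : measurable V -> measurable E ->
  nu (~` V `*` V) < +oo -> minimal V E -> perimeter V E < +oo.
Proof.
move=> mV mE Voo minE; apply: le_lt_trans (perimeter_setD_lty mV mE Voo).
apply: minE; first exact: measurableD.
by apply/seteqP; split => x /=; tauto.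
Qed.

(* If [perimeter V (E_ k) <= inf + 2^-k], submodularity bounds the perimeter of
   the union of the [E_ j], [j >= k], by [inf + 2 * 2^-k]; hence the upper limit
   of the minimizing sequence is a minimizer, without any compactness. *)
Lemma exists_minimal V A : measurable V -> measurable A ->
  nu (~` V `*` V) < +oo ->
  exists E, [/\ measurable E, E `\` V = A `\` V & minimal V E].
Proof.
move=> mV mA Voo.
pose adm F := measurable F /\ F `\` V = A `\` V.
have admU F G : adm F -> adm G -> adm (F `|` G).
  move=> [mF FA] [mG GA]; split; first exact: measurableU.
  by rewrite setDUl FA GA setUid.
have admI F G : adm F -> adm G -> adm (F `&` G).
  move=> [mF FA] [mG GA]; split; first exact: measurableI.
  by rewrite -[RHS]setIid -{1}FA -GA; apply/seteqP; split => x /=; tauto.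
pose P := perimeter V.
pose m := ereal_inf (P @` adm).
have m_le F : adm F -> m <= P F by move=> aF; apply: ereal_inf_lbound; exists F.
have mfin : m \is a fin_num.
  rewrite ge0_fin_numE; last by apply: le_ereal_inf_tmp => _ [F _ <-].
  apply: le_lt_trans (perimeter_setD_lty mV mA Voo); apply: m_le.
  by split; [exact: measurableD|apply/seteqP; split => x /=; tauto].
pose e k : R := (2^-1 ^+ k)%R.
have e_gt0 k : (0 < e k)%R by rewrite exprn_gt0.
have [E_ E_P] : {E_ : (set T)^nat & forall k, adm (E_ k) /\ P (E_ k) <= m + (e k)%:E}.
  apply: (@choice _ _ (fun k F => adm F /\ P F <= m + (e k)%:E)) => k.
  have [_ [F aF <-] /ltW ?] := lb_ereal_inf_adherent (e_gt0 k) mfin.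
  by exists F.
pose U k := fix U N := if N is N'.+1 then U N' `|` E_ (k + N)%N else E_ k.
have UE k N x : U k N x <-> exists2 j, (k <= j <= k + N)%N & E_ j x.
  elim: N => [|N IH] /=.
    rewrite addn0; split => [Ekx|[j]]; first by exists k; rewrite ?leqnn.
    by rewrite -eqn_leq => /eqP ->.
  split => [[/IH[j /andP[kj jN] Ejx]|Ex]|[j /andP[kj jN] Ejx]].
  - by exists j => //; rewrite kj addnS (leqW jN).
  - by exists (k + N.+1)%N => //; rewrite leq_addr leqnn.
  - move: jN; rewrite leq_eqVlt => /predU1P[<-|jN]; first by right.
    by left; apply/IH; exists j => //; rewrite kj -ltnS -addnS.
have U_adm k N : adm (U k N).
  by elim: N => [|N IH] /=; [exact: (E_P k).1|exact: admU IH (E_P _).1].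
(* The error is the sum of the [e j] for [j] from [k] to [k + N]. Adding one more set costs at most
   its own error, because the intersection that submodularity produces is admissible and so has
   perimeter at least [m]. *)
have U_le k N : P (U k N) <= m + (2 * e k - e (k + N)%N)%:E.
  elim: N => [|N IH] /=.
    rewrite addn0 (_ : (2 * e k - e k = e k)%R); first exact: (E_P k).2.
    by rewrite mulr_natl mulr2n addrK.
  have [aE PE] := E_P (k + N.+1)%N.
  have := perimeter_setUI mV (U_adm k N).1 aE.1.
  move/le_trans => /(_ _ (leeD IH PE)) H.
  have {}H : P (U k N `|` E_ (k + N.+1)%N) + m <=
      m + (2 * e k - e (k + N)%N)%:E + (m + (e (k + N.+1)%N)%:E).
    apply: le_trans H; rewrite leeD2l//; exact/m_le/admI.
  rewrite -(leeD2rE _ _ mfin); apply: (le_trans H).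
  rewrite -(fineK mfin) -!EFinD lee_fin.
  have -> : e (k + N.+1)%N = (e (k + N)%N / 2)%R by rewrite /e addnS exprSr.
  by lra.
pose G k := \bigcup_(j in [set j | (k <= j)%N]) E_ j.
have mG k : measurable (G k) by apply: bigcup_measurable => j _; exact: (E_P j).1.1.
have G_le k : P (G k) <= m + (2 * e k)%:E.
  apply: (@perimeter_le_lim _ _ (U k) 0%N) => //.
  - by move=> N; exact: (U_adm k N).1.
  - move=> x; have [[j kj Ejx]|nG] := pselect (G k x).
      exists j => N jN; split => _; first by exists j.
      by apply/UE; exists j => //; rewrite (kj : (k <= j)%N) (leq_trans jN) ?leq_addl.
    exists 0%N => N _; split => // /UE[j /andP[kj _] Ejx].
    by exists j.
  - move=> N _; apply: (le_trans (U_le k N)).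
    by rewrite leeD2l// lee_fin gerBl ltW.
(* The upper limit of the [E_ j]: the [G k] decrease to it, and semicontinuity is applied a second
   time. *)
pose E := \bigcap_k G k.
have mE : measurable E by exact: bigcap_measurable.
have E_le k0 : P E <= m + (2 * e k0)%:E.
  apply: (@perimeter_le_lim _ _ G k0) => //.
    move=> x; have [Ex|] := pselect (E x).
      by exists 0%N => k _; split => // _; exact: Ex.
    move=> nE; have [i nGi] : exists i, ~ G i x.
      by apply: contrapT => /forallNP H; apply: nE => i _; exact: contrapT (H i).
    exists i => k ik; split => // -[j kj Ejx]; exfalso; apply: nGi.
    by exists j => //; exact: leq_trans ik kj.
  move=> k kk; apply: (le_trans (G_le k)); rewrite leeD2l// lee_fin ler_pM2l//.
  by apply: ler_wiXn2l => //; lra.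
have EA : E `\` V = A `\` V.
  have ED j : E_ j `\` V = A `\` V := (E_P j).1.2.
  apply/seteqP; split => x [].
    by move=> /(_ 0%N I)[j _ Ejx] Vx; rewrite -(ED j).
  move=> Ax Vx; split => // k _; exists k; rewrite /=//.
  by have [] : (E_ k `\` V) x by rewrite ED.
exists E; split => //.
move=> F mF FE; apply: (@le_trans _ _ m); last by apply: m_le; split; rewrite ?FE.
apply/lee_addgt0Pr => r r0.
have : (fun k => e k) @ \oo --> (0 : R)%R.
  by apply: cvg_expr; rewrite gtr0_norm; lra.
move/cvgr0Pnorm_lt => /(_ (r / 2)%R); rewrite divr_gt0// => /(_ isT)[k _ /(_ k (leqnn k))].
rewrite /= gtr0_norm// => ek; apply: (le_trans (E_le k)).
by rewrite leeD2l// lee_fin; lra.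
Qed.

(** The union of the [V k] may have infinite interaction with its complement, so [exists_minimal] is
    applied to each [V k] and a decreasing limit is taken. *)
Lemma exists_minimal_exhaustion (V : (set T)^nat) A :
  (forall k, measurable (V k)) -> {homo V : i j / (i <= j)%N >-> i `<=` j} ->
  (forall k, nu (~` V k `*` V k) < +oo) -> measurable A ->
  exists E, [/\ measurable E, E `\` \bigcup_k V k = A `\` \bigcup_k V k &
    forall k, minimal (V k) E].
Proof.
move=> mV ndV Voo mA; set U := \bigcup_k V k.
have mU : measurable U by exact: bigcup_measurable.
have VU k : V k `<=` U by move=> x Vx; exists k.
have mUV k : measurable ((A `\` U) `|` (U `\` V k)).
  by apply: measurableU; exact: measurableD.
(* Filling the union [U] outside [V k] gives the largest exterior datum there, so that the data
   decrease with [k]. *)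
have [G GP] : {G : (set T)^nat & forall k, [/\ measurable (G k),
    G k `\` V k = ((A `\` U) `|` (U `\` V k)) `\` V k & minimal (V k) (G k)]}.
  apply: (@choice _ _ (fun k F => [/\ measurable F,
    F `\` V k = ((A `\` U) `|` (U `\` V k)) `\` V k & minimal (V k) F])) => k.
  exact: exists_minimal.
have GV k x : ~ V k x -> G k x <-> (A x /\ ~ U x) \/ U x.
  move=> nVx; have [_ /seteqP[/(_ x)/= H1 /(_ x)/= H2] _] := GP k; tauto.
pose E_ := fix E_ k := if k is k'.+1 then E_ k' `&` G k else G 0%N.
have mE_ k : measurable (E_ k).
  elim: k => [|k IH] /=; first by case: (GP 0%N).
  by apply: measurableI => //; case: (GP k.+1).
have E_V k x : ~ V k x -> E_ k x <-> (A x /\ ~ U x) \/ U x.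
  elim: k => [|k IH] nVx; first exact: GV.
  have nVk : ~ V k x by move=> Vx; apply: nVx; exact: ndV Vx.
  by rewrite /= IH// GV//; tauto.
(* Off [V k], [G k.+1] is contained in [E_ k]. Hence the union of the two competes with [E_ k] in
   [V k], and by submodularity their intersection has perimeter at most that of [G k.+1] in [V k].
   They agree off [V k], so the same holds in [V k.+1], and the intersection inherits minimality
   there. *)
have minE_ k : minimal (V k) (E_ k).
  elim: k => [|k IH]; first by case: (GP 0%N).
  have [mG _ minG] := GP k.+1.
  have VV : V k `<=` V k.+1 by exact: ndV.
  have EG : (E_ k `&` G k.+1) `\` V k = G k.+1 `\` V k.
    apply/seteqP; split => [x [[]]//|x [Gx nVx]]; split => //; split => //.
    apply/E_V => //; have [Vx|nV'] := pselect (V k.+1 x).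
      by right; exact: VU Vx.
    exact/(GV k.+1).
  have le1 : perimeter (V k) (E_ k `&` G k.+1) <= perimeter (V k) (G k.+1).
    have fE : perimeter (V k) (E_ k) \is a fin_num.
      by rewrite ge0_fin_numE//; exact: minimal_perimeter_lty.
    rewrite -(leeD2lE _ _ fE).
    apply: le_trans (perimeter_setUI (mV k) (mE_ k) mG).
    rewrite leeD2r//; apply: IH; first exact: measurableU.
    apply/seteqP; split => [x [[//|Gx] nVx]|x [Ex nVx]]; split => //; last by left.
    by have [[]] : ((E_ k `&` G k.+1) `\` V k) x by rewrite EG.
  have [r [r0 e1 e2]] := perimeter_local (mV k) (mV k.+1)
    (mE_ k.+1) mG VV EG.
  move=> F mF FE; rewrite e1; apply: (@le_trans _ _ (perimeter (V k.+1) (G k.+1))).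
    by rewrite e2 leeD2r.
  apply: minG => //; rewrite FE; apply/seteqP; split => x [Ex nVx]; split => //.
    by case: Ex.
  by apply/(E_V k.+1) => //; exact/(GV k.+1).
have E_anti i j : (i <= j)%N -> E_ j `<=` E_ i.
  move=> ij; rewrite -(subnKC ij); elim: (j - i)%N => [|l IH]; first by rewrite addn0.
  by rewrite addnS => x [/IH].
pose E := \bigcap_k E_ k.
have mE : measurable E by exact: bigcap_measurable.
have EE_ k : E `<=` E_ k by move=> x; exact.
exists E; split => //.
  apply/seteqP; split => x [Ex nUx]; split => //.
    have /E_V : E_ 0%N x by exact: EE_.
    by case=> [Vx|[]//|//]; apply: nUx; exact: VU Vx.
  by move=> k _; apply/E_V; [move=> Vx; apply: nUx; exact: VU Vx|left].
move=> j F mF FE.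
(* The competitor [F] for [E] becomes a competitor for [E_ k] by keeping it only inside [V j]. *)
pose G_ k := (F `&` V j) `|` (E_ k `\` V j).
have mG_ k : measurable (G_ k).
  by apply: measurableU; [exact: measurableI|exact: measurableD].
(* The only pairs that can cross [G_ k] without crossing [F]: they start in [E_ k] but not in [E],
   outside [V j], and end in [V j]. *)
pose X k := ((E_ k `\` E) `\` V j) `*` V j.
have mX k : measurable (X k) by apply: measurableX => //; do 2!apply: measurableD => //.
have EG_ k : (j <= k)%N -> perimeter (V j) (E_ k) <= perimeter (V j) (G_ k).
  move=> jk.
  have GE : G_ k `\` V j = E_ k `\` V j.
    by apply/seteqP; split => x; rewrite /G_/=; tauto.
  have [r [r0 e1 e2]] := perimeter_local (mV j) (mV k) (mG_ k) (mE_ k) (ndV _ _ jk) GE.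
  have : perimeter (V k) (E_ k) <= perimeter (V k) (G_ k).
    apply: minE_ => //; apply/seteqP; split => x [+ nVx];
      have nVj : ~ V j x by [move=> Vx; apply: nVx; exact: ndV Vx].
    - by case=> -[].
    - by move=> Ex; split => //; right.
  (* The common contribution [r] is at most the finite perimeter of [E_ k] in [V k], so it
     cancels. *)
  rewrite e1 e2 leeD2rE// ge0_fin_numE//.
  rewrite (le_lt_trans _ (minimal_perimeter_lty (mV k) (mE_ k) (Voo k) (minE_ k)))//.
  by rewrite e2 leeDr.
have GF k : perimeter (V j) (G_ k) <= perimeter (V j) F + nu (X k).
  apply: le_trans (measureU2 _ _ _); last 2 first.
  - exact: measurable_crossing.
  - by [].
  rewrite le_measure ?inE//; first exact: measurable_crossing.
    by apply: measurableU => //; exact: measurable_crossing.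
  move=> [x y] [[/= Gx nGy] Vxy].
  have Fx z : ~ V j z -> F z <-> E z.
    by move=> nVz; move/seteqP: FE => [/(_ z)/= ? /(_ z)/= ?]; tauto.
  have := EE_ k y; have := Fx x; have := Fx y; move: Gx nGy Vxy.
  rewrite /G_ /X /crossing/=.
  by have [] := pselect (V j x); have [] := pselect (E x); tauto.
have X_anti : {homo X : i j / (i <= j)%N >-> (j <= i)%O}.
  move=> a b ab; apply/subsetPset => -[x y] [/= [[Ex nEx] nVx] Vy].
  by split => //; split => //; split => //; exact: E_anti Ex.
have X0 : \bigcap_k X k = set0.
  apply/seteqP; split => // -[x y] Xxy.
  have [[[_ nEx] _] _] := Xxy 0%N I.
  by apply: nEx => k _; have [[[]]] := Xxy k I.
(* Continuity from above requires one set of finite measure. *)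
have X0oo : nu (X 0%N) < +oo.
  apply: le_lt_trans (Voo j); rewrite le_measure ?inE//.
    by apply: measurableX => //; exact: measurableC.
  by move=> [x y] [[]].
have cX : nu (X k) @[k --> \oo] --> 0.
  rewrite -(measure0 nu) -X0.
  by apply: nonincreasing_cvg_mu => //; rewrite X0.
(* Semicontinuity along the indices [l >= k], where [X l] is contained in [X k]. *)
have E_le k : (j <= k)%N -> perimeter (V j) E <= perimeter (V j) F + nu (X k).
  move=> jk; apply: (@perimeter_le_lim _ _ E_ k) => //.
    move=> x; have [Ex|] := pselect (E x).
      by exists 0%N => l _; split => // _; exact: Ex.
    move=> nE; have [i nEi] : exists i, ~ E_ i x.
      by apply: contrapT => /forallNP H; apply: nE => i _; exact: contrapT (H i).
    by exists i => l il; split => // /(E_anti _ _ il).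
  move=> l kl; apply: (le_trans (EG_ l (leq_trans jk kl))).
  apply: (le_trans (GF l)); rewrite leeD2l// le_measure ?inE//.
  exact/subsetPset/X_anti.
rewrite -[leRHS]adde0.
have cF : perimeter (V j) F + nu (X k) @[k --> \oo] --> perimeter (V j) F + 0.
  apply: cvgeD => //; last exact: cvg_cst.
  by rewrite /adde_def/= negb_and negb_and !orbT.
rewrite -(cvg_lim _ cF)//; apply: lime_ge; first exact: (cvgP _ cF).
by near=> k; apply: E_le; near: k; exists j.
Unshelve. all: by end_near. Qed.

End perimeter.

(** * The product Lebesgue measure on tuples *)

Section lebesgue_tuple_measure.
Context (R : realType).
Local Open Scope ereal_scope.
Let mR := measurableTypeR R.

(** [lebesgue_tuple] is a bare set function; product and extension theorems apply to it once it is
    identified with a sigma-finite measure, here the pushforward of a product under [cons_tuple]. *)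
Lemma lebesgue_tuple_measure n :
  exists m : {sigma_finite_measure set (n.-tuple mR) -> \bar R},
    @lebesgue_tuple R n = m.
Proof.
elim: n => [|n [m mE]]; first by exists \d_ ([tuple] : 0.-tuple mR).
pose f (p : mR * n.-tuple mR) : n.+1.-tuple mR := cons_tuple p.1 p.2.
have mf : measurable_fun [set: mR * n.-tuple mR] f by exact: measurable_cons.
pose m' := pushforward (@lebesgue_measure R \x m) f.
have sm' : sigma_finite setT m'.
  have /sigma_finiteP[F [TF ndF Foo]] := sigma_finiteT (@lebesgue_measure R).
  have /sigma_finiteP[G [TG ndG Goo]] := sigma_finiteT m.
  (* Splitting into head and tail is a measurable left inverse of [f], so preimages of rectangles
     under [g] have the measure of the rectangles. *)
  pose g (t : n.+1.-tuple mR) := (thead t, [tuple of behead t] : n.-tuple mR).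
  have mg : measurable_fun setT g.
    apply/measurable_fun_pairP; split; first exact: measurable_tnth.
    exact: measurable_behead.
  exists (fun k => g @^-1` (F k `*` G k)).
    apply/seteqP; split => // t _.
    have [i _ Fi] : (\bigcup_k F k) (g t).1 by rewrite -TF.
    have [j _ Gj] : (\bigcup_k G k) (g t).2 by rewrite -TG.
    exists (maxn i j) => //; split.
    - by move: Fi; exact/subsetPset/ndF/leq_maxl.
    - by move: Gj; exact/subsetPset/ndG/leq_maxr.
  move=> k; have [mF Fk] := Foo k; have [mG Gk] := Goo k; split.
    by rewrite -[X in measurable X]setTI; apply: mg => //; exact: measurableX.
  rewrite /m' /pushforward (_ : f @^-1` _ = F k `*` G k).
    by rewrite product_measure1E// lte_mul_pinfty// ge0_fin_numE.
  have gf p : g (f p) = p by case: p => x t; congr pair; exact/val_inj.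
  by apply/seteqP; split => p; [rewrite -{2}(gf p)|rewrite -{1}(gf p)]; exact.
pose M := HB.pack_for {sigma_finite_measure set (n.+1.-tuple mR) -> \bar R}
  m' (Measure_isSigmaFinite.Build _ _ _ m' sm').
exists (M mf mf mf); apply/funext => A /=; by rewrite mE.
Qed.

Lemma lebesgue_tuple_ball n (c : 'I_n -> R) (r : R) : (0 <= r)%R ->
  measurable [set t : n.-tuple mR | forall i, ball (c i) r (tnth t i)] /\
  lebesgue_tuple [set t : n.-tuple mR | forall i, ball (c i) r (tnth t i)]
    = ((r *+ 2) ^+ n)%:E.
Proof.
move=> r0.
have mb (x : R) : measurable (ball x r : set mR).
  by rewrite ball_itv; exact: measurable_itv.
have mB m (c' : 'I_m -> R) :
    measurable [set t : m.-tuple mR | forall i, ball (c' i) r (tnth t i)].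
  rewrite (_ : [set _ | _] = \bigcap_(i in [set: 'I_m])
    ((@tnth m mR)^~ i @^-1` ball (c' i) r)); last first.
    by apply/seteqP; split => [t H i _|t H i]; exact: H.
  apply: fin_bigcap_measurable => [|i _]; first exact: finite_finset.
  have := @measurable_tnth _ mR m i measurableT _ (mb (c' i)).
  by rewrite setTI.
split; first exact: mB.
elim: n c => [|n IH] c.
  rewrite /= expr0 diracE mem_set//.
  by move=> i; have := ltn_ord i.
rewrite /= exprS EFinM -(IH (fun i => c (lift ord0 i))) -(lebesgue_measure_ball (c ord0) r0).
have [m ->] := lebesgue_tuple_measure n.
rewrite -product_measure1E; [|exact: mb|exact: mB].
congr ((_ \x _) _); apply/seteqP; split => [[x t]/= H|[x t]/= [H0 H] i].
  split => [|i]; first exact: (H ord0).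
  by have := H (lift ord0 i); rewrite tnthS.
by case: (unliftP ord0 i) => [j ->|->] //; rewrite tnthS.
Qed.

End lebesgue_tuple_measure.

(** * Lebesgue measure on row vectors *)

Section lebesgue_rV.
Context (R : realType) (n : nat).
Local Open Scope ereal_scope.
Let mR := measurableTypeR R.
Let mu := @lebesgue_rV R n.

(** A set measurable for the product sigma-algebra satisfies the Caratheodory criterion, and its
    outer measure is its product measure. *)
Lemma lebesgue_rV_tuple (A : set 'rV[R]_n) :
  measurable [set t : n.-tuple mR | A (\row_i tnth t i)] ->
  lebesgue_measurable A /\
  mu A = lebesgue_tuple [set t : n.-tuple mR | A (\row_i tnth t i)].
Proof.
have [m mE] := lebesgue_tuple_measure R n.
move=> mA; split; last first.
  by rewrite /mu /lebesgue_rV /lebesgue_outer mE measurable_mu_extE.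
have H : forall X, ((@lebesgue_tuple R n)^*)%mu X =
    ((@lebesgue_tuple R n)^*)%mu (X `&` [set t | A (\row_i tnth t i)]) +
    ((@lebesgue_tuple R n)^*)%mu (X `&` ~` [set t | A (\row_i tnth t i)]).
  by rewrite mE; exact: (@caratheodory_measurable_mu_ext _ _ _ m _ mA).
by move=> X; exact: H.
Qed.

Lemma measurable_coord (i : 'I_n) :
  measurable_fun setT (fun x : lebesgueType R n => (x : 'rV[R]_n) ord0 i).
Proof.
move=> _ Y mY; rewrite setTI.
suff : lebesgue_measurable ((fun x : 'rV[R]_n => x ord0 i) @^-1` Y) by [].
apply: (proj1 (lebesgue_rV_tuple _)).
rewrite (_ : [set _ | _] = (@tnth n mR)^~ i @^-1` Y); last first.
  by apply/seteqP; split => t /=; rewrite mxE.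
by rewrite -[X in measurable X]setTI; exact: measurable_tnth.
Qed.

Lemma lebesgue_rV_ball (c : 'rV[R]_n) (r : R) : (0 < r)%R ->
  lebesgue_measurable (ball c r) /\ mu (ball c r) = ((r *+ 2) ^+ n)%:E.
Proof.
move=> r0.
have [mB <-] := lebesgue_tuple_ball (fun i => c ord0 i) (ltW r0).
suff <- : [set t : n.-tuple mR | ball c r (\row_i tnth t i)] =
  [set t : n.-tuple mR | forall i, ball (c ord0 i) r (tnth t i)].
  apply: lebesgue_rV_tuple.
  rewrite (_ : [set _ | _] = [set t | forall i, ball (c ord0 i) r (tnth t i)])//.
  apply/seteqP; split => [t [_ H] i|t H]; first by have := H ord0 i; rewrite mxE.
  by split => // i j; rewrite ord1 mxE.
apply/seteqP; split => [t [_ H] i|t H]; first by have := H ord0 i; rewrite mxE.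
by split => // i j; rewrite ord1 mxE.
Qed.

Lemma lebesgue_rV_sigma_finite : sigma_finite setT mu.
Proof.
exists (fun k => ball (0%R : 'rV[R]_n) k.+1%:R).
  apply/seteqP; split => // x _.
  exists (Num.truncn `|x|) => //.
  by rewrite -ball_normE /= sub0r normrN truncnS_gt.
move=> k; have [? e] := @lebesgue_rV_ball 0%R k.+1%:R (ltr0Sn _ k).
by split => //; rewrite e ltry.
Qed.

End lebesgue_rV.

HB.instance Definition _ (R : realType) (n : nat) :=
  @Measure_isSigmaFinite.Build _ (lebesgueType R n) R (@lebesgue_rV R n)
    (lebesgue_rV_sigma_finite R n).

(** * Measures on pairs given by a density *)

Section pair_density.
Context d (T : measurableType d) (R : realType).
Variables (mu : {sigma_finite_measure set T -> \bar R}) (k : T * T -> \bar R).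
Local Open Scope ereal_scope.
Hypothesis mk : measurable_fun setT k.
Hypothesis k0 : forall z, 0 <= k z.

Lemma density_measure : exists nu : {measure set (T * T) -> \bar R},
  forall A, nu A = \int[mu \x mu]_(z in A) k z.
Proof.
pose f A := \int[mu \x mu]_(z in A) k z.
have f0 : f set0 = 0 by rewrite /f integral_set0.
have f_ge0 A : 0 <= f A by apply: integral_ge0.
have fs : semi_sigma_additive f by exact: semi_sigma_additive_nng_induced.
pose M := HB.pack_for {measure set (T * T) -> \bar R} f
  (isMeasure.Build _ (T * T)%type _ f f0 f_ge0 fs).
by exists M.
Qed.

(** Tonelli's theorem: it turns the iterated integral in [interaction] into the measure of a
    rectangle. *)
Lemma integral_setX (A B : set T) : measurable A -> measurable B ->
  \int[mu \x mu]_(z in A `*` B) k z = \int[mu]_(x in A) \int[mu]_(y in B) k (x, y).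
Proof.
move=> mA mB; rewrite integral_mkcond fubini_tonelli1; first last.
- by move=> z; rewrite erestrict_ge0.
- by apply/(measurable_restrictT _ _).1 => //;
    [exact: measurableX|exact: measurable_funTS].
rewrite [RHS]integral_mkcond; apply: eq_integral => x _.
rewrite /fubini_F /patch; case: ifPn => xA.
  rewrite [RHS]integral_mkcond; apply: eq_integral => y _.
  by rewrite /patch in_setX xA.
by apply: integral0_eq => y _; rewrite in_setX (negbTE xA).
Qed.

Lemma integral_null_setX (N : set T) : measurable N -> mu N = 0 ->
  \int[mu \x mu]_(z in N `*` setT) k z = 0 /\
  \int[mu \x mu]_(z in setT `*` N) k z = 0.
Proof.
move=> mN N0; split; apply: null_set_integral.
- exact: measurableX.
- exact: measurable_funTS.
- by rewrite -(mul0e (mu setT)) -N0; exact: product_measure1E.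
- exact: measurableX.
- exact: measurable_funTS.
- by rewrite -(mule0 (mu setT)) -N0; exact: product_measure1E.
Qed.

Lemma measure_le_density (A : set (T * T)) (a : R) : measurable A ->
  (forall z, A z -> k z <= a%:E) ->
  \int[mu \x mu]_(z in A) k z <= a%:E * (mu \x mu) A.
Proof.
move=> mA ka; rewrite -integral_cst//; apply: ge0_le_integral => //.
exact: measurable_funTS.
Qed.

End pair_density.

(** * The fractional kernel: measurability and decay *)

Section kernel.
Context (R : realType) (n : nat) (s : R).
Local Open Scope ereal_scope.
Let T := lebesgueType R n.
Let mu := @lebesgue_rV R n.

(* [edist] alone would be the extended distance of MathComp-Analysis. *)
Definition kernel (z : T * T) : \bar R :=
  ((@Defs.edist R n z.1 z.2 `^ (n%:R + s))^-1)%:E.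

Lemma kernel_ge0 z : 0 <= kernel z.
Proof. by rewrite lee_fin invr_ge0 powR_ge0. Qed.

Lemma measurable_kernel : measurable_fun setT kernel.
Proof.
apply/measurable_EFinP.
(* Square root and inverse are written as real powers, so that measurability of [powR] covers
   both. *)
rewrite (_ : (fun _ => _) = (fun z : T * T => ((\sum_(i < n)
  ((z.1 : 'rV[R]_n) ord0 i - (z.2 : 'rV[R]_n) ord0 i) ^+ 2) `^ 2^-1) `^ (- (n%:R + s)))%R); last first.
  apply/funext => z; rewrite powRN powR12_sqrt//.
  by apply: sumr_ge0 => i _; exact: sqr_ge0.
do 2 (apply: (measurableT_comp (measurable_powR _))).
apply: measurable_sum => i; apply: measurable_funX; apply: measurable_funB.
- exact: (measurableT_comp (measurable_coord i)).
- exact: (measurableT_comp (measurable_coord i)).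
Qed.

Lemma measurable_near_diagonal (t : R) :
  measurable [set z : T * T | ball (z.1 : 'rV[R]_n) t (z.2 : 'rV[R]_n)].
Proof.
have [t0|t0] := ltP 0%R t; last first.
  rewrite (_ : [set _ | _] = set0)//; apply/seteqP; split => // z [].
  by rewrite ltNge t0.
rewrite (_ : [set _ | _] = \bigcap_(i in [set: 'I_n]) [set z : T * T |
  ((z.1 : 'rV[R]_n) ord0 i - (z.2 : 'rV[R]_n) ord0 i)%R \in `](- t), t[%R]); last first.
  apply/seteqP; split => [z [_ H] i _|z H].
    by have := H ord0 i; rewrite /ball/= /ball_ ltr_norml in_itv.
  split => // i j; rewrite ord1.
  by have := H j I; rewrite /ball/= /ball_ ltr_norml in_itv.
apply: fin_bigcap_measurable => [|i _]; first exact: finite_finset.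
have mD : measurable_fun setT (fun z : T * T =>
    (z.1 : 'rV[R]_n) ord0 i - (z.2 : 'rV[R]_n) ord0 i)%R.
  by apply: measurable_funB; exact: (measurableT_comp (measurable_coord i)).
have := mD measurableT _ (measurable_itv `](- t)%R, t[).
by rewrite setTI.
Qed.

(** Outside the sup-norm ball some coordinate difference is at least [t], and the Euclidean distance
    dominates it. *)
Lemma kernel_le (t : R) (z : T * T) : (0 < t)%R -> (0 <= n%:R + s)%R ->
  ~ ball (z.1 : 'rV[R]_n) t (z.2 : 'rV[R]_n) ->
  kernel z <= ((t `^ (n%:R + s))^-1)%:E.
Proof.
move=> t0 p0 nb.
have [i ti] : exists i, (t <= `|(z.1 : 'rV[R]_n) ord0 i - (z.2 : 'rV[R]_n) ord0 i|)%R.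
  apply: contrapT => /forallNP H; apply: nb; split => // a i; rewrite ord1.
  by have /negP := H i; rewrite -ltNge.
have te : (t <= @Defs.edist R n z.1 z.2)%R.
  apply: (le_trans ti); rewrite -sqrtr_sqr ler_sqrt.
    rewrite (bigD1 i)//= lerDl; apply: sumr_ge0 => j _; exact: sqr_ge0.
  by apply: sumr_ge0 => j _; exact: sqr_ge0.
rewrite lee_fin lef_pV2 ?posrE ?powR_gt0//; last exact: lt_le_trans te.
by apply: ge0_ler_powR => //; rewrite nnegrE ltW//; exact: lt_le_trans te.
Qed.

End kernel.

(** * Numerical bounds on dyadic scales *)

Section dyadic_estimates.
Context (R : realType).
Implicit Types (r s : R) (n j : nat).

(** This makes both ratios [2]^ s / 2[and](2 [^ s)^-1] of the geometric series less than 1. *)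
Lemma powR2_gt1_lt2 s : 0 < s < 1 -> 1 < (2 : R) `^ s < 2.
Proof.
have gt1 (a : R) : 0 < a -> 1 < (2 : R) `^ a.
  by move=> a0; apply: (@le_lt_trans _ _ (1 `^ a)); [by rewrite powR1|rewrite gt0_ltr_powR// ?nnegrE; lra].
move=> /andP[s0 s1]; rewrite gt1//=.
have e : (2 : R) = 2 `^ (1 - s) * 2 `^ s.
  by rewrite -powRD ?subrK ?powRr1//; apply/implyP => _; lra.
by rewrite [ltRHS]e ltr_pMl ?powR_gt0// gt1// subr_gt0.
Qed.

Lemma powR_dyadic r (p : R) j : 0 < r ->
  (r * 2 ^+ j) `^ p = r `^ p * (2 `^ p) ^+ j.
Proof.
move=> r0; rewrite powRM ?exprn_ge0//; last exact: ltW.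
rewrite -(powR_mulrn j (powR_ge0 2 p)) -[2 ^+ j](powR_mulrn j (ler0n R 2)).
by rewrite -!powRrM [p * _]mulrC.
Qed.

(** With [u] equal to [2 ^- j], this bounds the relative volume of a thin shell linearly in its
    thickness. *)
Lemma expr1D_le (u : R) n : 0 <= u <= 1 -> (1 + u) ^+ n - 1 <= 2 ^+ n * u.
Proof.
move=> /andP[u0 u1]; elim: n => [|n IH]; first by rewrite !expr0 mul1r subrr.
have le2 : (1 + u) ^+ n <= 2 ^+ n by rewrite lerXn2r// ?nnegrE; lra.
have : 0 <= u * (2 ^+ n - (1 + u) ^+ n) by rewrite mulr_ge0// subr_ge0.
by rewrite !exprS; lra.
Qed.

Lemma near_estimate r s n j : 0 < r ->
  ((r / 2 ^+ j.+1) `^ (n%:R + s))^-1 *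
    (((r / 2 ^+ j) *+ 2) ^+ n * (((r + r / 2 ^+ j) *+ 2) ^+ n - (r *+ 2) ^+ n)) <=
  2 `^ (n%:R + s) / r `^ (n%:R + s) * (r *+ 2) ^+ n * (r *+ 2) ^+ n * 2 ^+ n *
    (2 `^ s / 2) ^+ j.
Proof.
move=> r0; set p := n%:R + s; set g := 2 `^ s; set v := 2 ^+ j.
have v0 : 0 < v by rewrite exprn_gt0.
have rp0 : 0 < r `^ p by rewrite powR_gt0.
have w0 : 0 < (2 : R) `^ p by rewrite powR_gt0.
have wE : (2 : R) `^ p = 2 ^+ n * g.
  by rewrite /p powRD ?powR_mulrn//; apply/implyP => _; lra.
have g0 : 0 < g by rewrite powR_gt0.
have -> : ((r / 2 ^+ j.+1) `^ p)^-1 = (2 `^ p) ^+ j.+1 / r `^ p.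
  have r'0 : 0 < r / 2 ^+ j.+1 by rewrite divr_gt0// exprn_gt0.
  have := powR_dyadic p j.+1 r'0; rewrite divfK ?gt_eqF ?exprn_gt0// => ->.
  set X := _ `^ p; have X0 : 0 < X by rewrite powR_gt0.
  set W := _ ^+ j.+1; have W0 : 0 < W by rewrite exprn_gt0.
  by field; rewrite !gt_eqF.
have -> : (r / v) *+ 2 = (r *+ 2) / v by rewrite mulrnAl.
have -> : (r + r / v) *+ 2 = (r *+ 2) * (1 + v^-1) by rewrite mulrDr mulr1 mulrnDl mulrnAl.
rewrite [(_ * (1 + _)) ^+ n]exprMn -[X in _ - X]mulr1 -mulrBr expr_div_n.
have u01 : 0 <= v^-1 <= 1.
  rewrite invr_ge0 (ltW v0)/= invf_le1// exprn_ege1//; lra.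
have := expr1D_le n u01; set D := _ - 1 => D_le.
set b := (r *+ 2) ^+ n.
have b0 : 0 < b by rewrite exprn_gt0// mulrn_wgt0.
have vE : v ^+ n = (2 ^+ n) ^+ j by rewrite /v -!exprM mulnC.
have -> : (2 `^ p) ^+ j.+1 / r `^ p * (b / v ^+ n * (b * D)) =
    2 `^ p / r `^ p * b * b * g ^+ j * D.
  rewrite exprS (_ : (2 `^ p) ^+ j = (2 ^+ n) ^+ j * g ^+ j) ?wE ?exprMn// vE.
  by field; rewrite !gt_eqF// exprn_gt0// exprn_gt0.
rewrite expr_div_n -/v [leRHS](_ : _ =
  2 `^ p / r `^ p * b * b * g ^+ j * (2 ^+ n * v^-1)); last first.
  by field; rewrite gt_eqF//= gt_eqF.
by rewrite ler_wpM2l// ltW// !(mulr_gt0, invr_gt0, exprn_gt0)//;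
  rewrite mulrn_wgt0.
Qed.

(** With [t] equal to [r * 2 ^+ j], the kernel at distance [t] is multiplied by the volumes of balls
    of radii [r + 2 t] and [r]. Since [r <= t], the larger ball has diameter at most [6 t]. *)
Lemma far_estimate r s n j : 0 < r ->
  ((r * 2 ^+ j) `^ (n%:R + s))^-1 *
    (((r + r * 2 ^+ j.+1) *+ 2) ^+ n * (r *+ 2) ^+ n) <=
  (r `^ (n%:R + s))^-1 * (r * 6) ^+ n * (r *+ 2) ^+ n * (2 `^ s)^-1 ^+ j.
Proof.
move=> r0; set p := n%:R + s; set g := 2 `^ s.
have v1 : 1 <= (2 : R) ^+ j by rewrite exprn_ege1//; lra.
have rp0 : 0 < r `^ p by rewrite powR_gt0.
have g0 : 0 < g by rewrite powR_gt0.
rewrite powR_dyadic// (_ : 2 `^ p = 2 ^+ n * g); last first.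
  by rewrite /p powRD ?powR_mulrn//; apply/implyP => _; lra.
set b := (r *+ 2) ^+ n.
have b0 : 0 < b by rewrite exprn_gt0// mulrn_wgt0.
rewrite [leRHS](_ : _ = (r `^ p * (2 ^+ n * g) ^+ j)^-1 *
   ((r * 6 * 2 ^+ j) ^+ n * b)); last first.
  rewrite !exprMn (_ : (2 ^+ j) ^+ n = (2 ^+ n) ^+ j); last by rewrite -!exprM mulnC.
  rewrite exprVn; field.
  by rewrite !gt_eqF//= !exprn_gt0.
rewrite ler_wpM2l//.
  by rewrite invr_ge0 mulr_ge0 ?exprn_ge0 ?mulr_ge0 ?exprn_ge0// ltW.
rewrite ler_wpM2r ?(ltW b0)// lerXn2r ?nnegrE//.
all: by rewrite ?exprS; nra.
Qed.

End dyadic_estimates.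

(** * Finiteness from a cover with geometrically decaying measures *)

Section geometric_cover.
Context d (T : measurableType d) (R : realType) (nu : {measure set T -> \bar R}).
Local Open Scope ereal_scope.

Lemma measure_geometric_cover_lty (S : set T) (S_ : (set T)^nat) (C q : R) :
  measurable S -> (forall j, measurable (S_ j)) -> S `<=` \bigcup_j S_ j ->
  (0 <= q < 1)%R -> (forall j, nu (S_ j) <= (C * q ^+ j)%:E) -> nu S < +oo.
Proof.
move=> mS mS_ SS /andP[q0 q1] nuS.
have C0 : (0 <= C)%R.
  by have := le_trans (measure_ge0 _ _) (nuS 0%N); rewrite expr0 mulr1 lee_fin.
apply: (@le_lt_trans _ _ (C / (1 - q))%:E); last exact: ltry.
apply: (le_trans (measure_sigma_subadditive nu mS_ mS SS)).
apply: (le_trans (lee_nneseries _ (fun j _ => nuS j))) => //.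
apply: lime_le.
  by apply: is_cvg_nneseries => j _ _; rewrite lee_fin mulr_ge0// exprn_ge0.
apply: nearW => m; rewrite sumEFin lee_fin.
have := @geometric_seriesE R C q; rewrite lt_eqF// => /(_ isT)/(congr1 (fun f => f m)).
rewrite /series/= => ->; rewrite ler_wpM2r ?invr_ge0 ?subr_ge0 ?(ltW q1)//.
by rewrite ler_piMr// gerBl exprn_ge0.
Qed.

End geometric_cover.

(** * Finite interaction of a ball with its complement *)

Section ball_interaction.
Context (R : realType) (n : nat) (s : R).
Local Open Scope ereal_scope.
Let T := lebesgueType R n.
Let mu := @lebesgue_rV R n.

(** The slice over each [x] in [Q] is a ball of radius [t]. *)
Lemma product_near_diagonal (Q : set T) (t : R) : measurable Q -> (0 < t)%R ->
  (mu \x mu) [set z : T * T | Q z.1 /\ ball (z.1 : 'rV[R]_n) t (z.2 : 'rV[R]_n)]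
    = ((t *+ 2) ^+ n)%:E * mu Q.
Proof.
move=> mQ t0; rewrite -(integral_cst mu)// integral_mkcond.
apply: eq_integral => x _; rewrite /patch /=; case: ifPn => xQ.
  rewrite (_ : xsection _ _ = (ball (x : 'rV[R]_n) t : set T)).
    by have [_ H] := lebesgue_rV_ball (x : 'rV[R]_n) t0; exact: H.
  apply/seteqP; split => y; rewrite /xsection/= inE /=; first by case.
  by split => //; rewrite inE in xQ.
rewrite (_ : xsection _ _ = set0); first exact: (measure0 (@lebesgue_rV R n)).
apply/seteqP; split => // y.
by rewrite /xsection/= inE /= => -[Qx _]; rewrite notin_setE in xQ.
Qed.

Variable nu : {measure set (T * T) -> \bar R}.
Hypothesis nuE : forall A, nu A = \int[mu \x mu]_(z in A) kernel s z.
Hypothesis s01 : (0 < s < 1)%R.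

Lemma density_not_near_le (A : set (T * T)) (t : R) : (0 < t)%R ->
  measurable A -> (forall z, A z -> ~ ball (z.1 : 'rV[R]_n) t (z.2 : 'rV[R]_n)) ->
  nu A <= ((t `^ (n%:R + s))^-1)%:E * (mu \x mu) A.
Proof.
move=> t0 mA nA; rewrite nuE; apply: measure_le_density => //.
- exact: measurable_kernel.
- exact: kernel_ge0.
- move=> z Az; apply: kernel_le => //; last exact: nA.
  by rewrite addr_ge0//; case/andP: s01 => /ltW.
Qed.

(* The pairs at distance between [t / 2] and [t <= r] have their first component
   in the shell [ball c (r + t) `\` ball c r], of volume [O(t)], and contribute
   [O(t ^ (1 - s))]; those at distance between [t >= r] and [2 t] contribute
   [O(t ^ -s)].  Both bounds are summable over dyadic [t]. *)
Lemma density_ball_lty (c : 'rV[R]_n) (r : R) :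
  nu (~` (ball c r : set T) `*` (ball c r : set T)) < +oo.
Proof.
have [r0|r0] := ltP 0%R r; last first.
  rewrite (_ : _ `*` _ = set0) ?measure0//; apply/seteqP; split => // -[x y] [_ []].
  by rewrite ltNge r0.
set B : set T := ball c r.
have mball (r' : R) : (0 < r')%R -> measurable (ball c r' : set T).
  by move=> r'0; have [] := lebesgue_rV_ball c r'0.
have vball (r' : R) : (0 < r')%R -> mu (ball c r' : set T) = ((r' *+ 2) ^+ n)%:E.
  by move=> r'0; have [] := lebesgue_rV_ball c r'0.
have vball_lty (r' : R) : (0 < r')%R -> mu (ball c r' : set T) < +oo.
  by move=> r'0; rewrite vball// ltry.
have mB : measurable B := mball r r0.
have sub_ball (x y : 'rV[R]_n) (t : R) : ball c r y -> ball x t y -> ball c (r + t) x.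
  by move=> By xy; exact: ball_triangle By (ball_sym xy).
pose D (t : R) := [set z : T * T | ball (z.1 : 'rV[R]_n) t (z.2 : 'rV[R]_n)].
have mD t : measurable (D t) := measurable_near_diagonal t.
pose S := ~` B `*` B.
have mS : measurable S by apply: measurableX => //; exact: measurableC.
have /andP[s1 s2] := powR2_gt1_lt2 s01.
have q1 : (0 <= (2 : R) `^ s / 2 < 1)%R by lra.
have q2 : (0 <= ((2 : R) `^ s)^-1 < 1)%R.
  by rewrite invr_ge0 powR_ge0 invf_lt1 ?powR_gt0.
have e0 j : (0 < (2 : R) ^+ j)%R by rewrite exprn_gt0.
have near_lty : nu (S `&` D r) < +oo.
  pose N j := S `&` (D (r / 2 ^+ j)%R `\` D (r / 2 ^+ j.+1)%R).
  have mN j : measurable (N j) by apply: measurableI => //; exact: measurableD.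
  apply: (measure_geometric_cover_lty _ mN _ q1).
  - exact: measurableI.
  - move=> [x y] [[/= nBx By] Dxy].
    have d0 : (0 < `|(x : 'rV[R]_n) - (y : 'rV[R]_n)|)%R.
      by rewrite normr_gt0 subr_eq0; apply/eqP => xy; apply: nBx; rewrite xy.
    (* The first scale at which the pair is no longer close; it exists because [x] and [y] are
       distinct. *)
    have exP : exists j, ~~ `[< D (r / 2 ^+ j.+1)%R (x, y) >].
      have : (fun k => r * 2^-1 ^+ k)%R @ \oo --> (r * 0 : R)%R.
        by apply: cvgMr; apply: cvg_expr; rewrite gtr0_norm; lra.
      rewrite mulr0 => /cvgr0Pnorm_lt => /(_ _ d0)[k _ /(_ k.+1 (leqnSn k))].
      rewrite gtr0_norm ?mulr_gt0 ?exprn_gt0// => kd.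
      exists k; apply/asboolPn; rewrite /D /= -ball_normE /=.
      by apply/negP; rewrite -leNgt -exprVn ltW.
    have [i Pi mini] := ex_minnP exP.
    exists i => //; split => //; split; last exact/asboolPn.
    (* Closeness at scale [i] is the hypothesis when [i] is 0, and otherwise follows from minimality
       of [i]. *)
    case: i Pi mini => [|i] Pi mini; first by rewrite expr0 divr1.
    by apply: contrapT => /asboolPn /mini; rewrite ltnn.
  - move=> j; set t := (r / 2 ^+ j)%R; set t' := (r / 2 ^+ j.+1)%R.
    have t0 : (0 < t)%R by rewrite divr_gt0.
    have t'0 : (0 < t')%R by rewrite divr_gt0.
    have rt0 : (0 < r + t)%R by rewrite addr_gt0.
    pose Q : set T := (ball c (r + t) : set T) `\` B.
    have mQ : measurable Q by apply: measurableD => //; exact: mball.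
    have muQ : mu Q = (((r + t) *+ 2) ^+ n - (r *+ 2) ^+ n)%:E.
      rewrite /mu /Q measureD//; [|exact: mball|exact: vball_lty].
      rewrite setIidr; last first.
        by apply: le_ball; rewrite lerDl ltW.
      by rewrite EFinB; congr (_ - _); exact: vball.
    apply: (le_trans (density_not_near_le t'0 (mN j) _)) => [z [_ []]//|].
    apply: (@le_trans _ _ (((t' `^ (n%:R + s))^-1)%:E * (((t *+ 2) ^+ n)%:E * mu Q))).
      rewrite lee_wpmul2l ?lee_fin ?invr_ge0 ?powR_ge0// -product_near_diagonal//.
      rewrite le_measure ?inE//.
        rewrite (_ : [set _ | _] = (Q `*` setT) `&` D t).
          by apply: measurableI => //; exact: measurableX.
        by apply/seteqP; split => z /=; tauto.
      move=> [x y] [[/= nBx By] [Dxy _]]; split => //=; split => //.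
      exact: sub_ball By Dxy.
    rewrite muQ -!EFinM lee_fin; exact: near_estimate.
have far_lty : nu (S `\` D r) < +oo.
  pose N j := S `&` (D (r * 2 ^+ j.+1)%R `\` D (r * 2 ^+ j)%R).
  have mN j : measurable (N j) by apply: measurableI => //; exact: measurableD.
  apply: (measure_geometric_cover_lty _ mN _ q2).
  - exact: measurableD.
  - move=> [x y] [Sxy nDxy].
    have exP : exists j, `[< D (r * 2 ^+ j.+1)%R (x, y) >].
      set d := `|(x : 'rV[R]_n) - (y : 'rV[R]_n)|%R.
      (* [d / r] is below its truncation plus one, which is below 2 to that power. *)
      exists (Num.truncn (d / r)); apply/asboolP; rewrite /D /= -ball_normE /=.
      rewrite -/d mulrC -ltr_pdivrMr//; apply: (lt_trans (truncnS_gt _)).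
      by rewrite -natrX ltr_nat ltn_expl.
    have [i Pi mini] := ex_minnP exP.
    exists i => //; split => //; split; first exact/asboolP.
    case: i Pi mini => [|i] Pi mini; first by rewrite expr0 mulr1.
    by move=> /asboolP /mini; rewrite ltnn.
  - move=> j; set t := (r * 2 ^+ j)%R; set t' := (r * 2 ^+ j.+1)%R.
    have t0 : (0 < t)%R by rewrite mulr_gt0.
    have t'0 : (0 < t')%R by rewrite mulr_gt0.
    have rt0 : (0 < r + t')%R by rewrite addr_gt0.
    apply: (le_trans (density_not_near_le t0 (mN j) _)) => [z [_ []]//|].
    apply: (@le_trans _ _ (((t `^ (n%:R + s))^-1)%:E *
        (mu (ball c (r + t') : set T) * mu B))).
      rewrite lee_wpmul2l ?lee_fin ?invr_ge0 ?powR_ge0//.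
      rewrite -product_measure1E//; last exact: mball.
      rewrite le_measure ?inE//; first by apply: measurableX => //; exact: mball.
      move=> [x y] [[/= nBx By] [Dxy _]]; split => //=.
      exact: sub_ball By Dxy.
    rewrite !vball// -!EFinM lee_fin; exact: far_estimate.
rewrite -/S -(setUIDK S (D r)).
apply: (le_lt_trans (measureU2 _ _ _)); [exact: measurableI|exact: measurableD|].
by rewrite lte_add_pinfty.
Qed.

End ball_interaction.

(** * Countable covers of open sets by balls *)

Section ball_cover.
Context (R : realType) (n : nat).

Lemma open_countable_balls (O : set 'rV[R]_n) : open O ->
  exists c : nat -> 'rV[R]_n, exists r : nat -> R,
    O = \bigcup_i ball (c i) (r i).
Proof.
move=> oO.
pose qb (q : 'rV[rat]_n * rat) : 'rV[R]_n * R := (map_mx ratr q.1, ratr q.2).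
(* Indices that code no rational ball inside [O] get radius 0, hence the empty ball. *)
pose cr i : 'rV[R]_n * R := if unpickle i is Some q then
  if `[< ball (qb q).1 (qb q).2 `<=` O >] then qb q else (0, 0) else (0, 0).
exists (fun i => (cr i).1), (fun i => (cr i).2).
apply/seteqP; split => [x Ox|x [i _]]; last first.
  have ball0 : ball (0 : 'rV[R]_n) 0 x -> O x by case; rewrite ltxx.
  rewrite /cr; case: unpickle => [q|]; last exact: ball0.
  by case: ifPn => [/asboolP|_]; [exact|exact: ball0].
have /nbhs_ballP[e /= e0 xeO] : nbhs x O by exact: open_nbhs_nbhs.
have [q qx] : exists q : 'rV[rat]_n, forall i, `|ratr (q ord0 i) - x ord0 i| < e / 4.
  have H i : {q : rat | `|ratr q - x ord0 i| < e / 4}.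
    apply/cid; have [|q] := @rat_in_itvoo R (x ord0 i - e / 4) (x ord0 i + e / 4).
      by lra.
    by rewrite in_itv /= => /andP[? ?]; exists q; rewrite ltr_norml; apply/andP; split; lra.
  by exists (\row_i sval (H i)) => i; rewrite mxE; exact: svalP (H i).
(* A radius above [e / 4] captures [x]; below [e / 2] it keeps the ball within distance [e] of
   [x]. *)
have [rho] := @rat_in_itvoo R (e / 4) (e / 2) ltac:(lra).
rewrite in_itv /= => /andP[rho1 rho2].
exists (pickle (q, rho)) => //; rewrite /cr pickleK.
have qx_ball (t : R) : e / 4 <= t -> ball (map_mx ratr q : 'rV[R]_n) t x.
  move=> et; split; first by lra.
  by move=> a i; rewrite ord1 mxE; exact: lt_le_trans (qx i) et.
case: ifPn => [_|/asboolPn]; first by apply: qx_ball; rewrite ltW.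
case=> y /= qy; apply: xeO; apply: (@le_ball _ _ x (e / 4 + ratr rho)); first by lra.
by apply: (ball_triangle _ qy); apply: ball_sym; exact: qx_ball.
Qed.

Lemma lebesgue_measurable_ball (c : 'rV[R]_n) (r : R) :
  lebesgue_measurable (ball c r).
Proof.
have [r0|r0] := ltP 0 r; first by have [] := lebesgue_rV_ball c r0.
rewrite (_ : ball c r = set0); first exact: (@measurable0 _ (lebesgueType R n)).
by apply/seteqP; split => // x []; rewrite ltNge r0.
Qed.

Lemma lebesgue_measurable_open (O : set 'rV[R]_n) : open O -> lebesgue_measurable O.
Proof.
move=> /open_countable_balls[c [r ->]].
apply: (@bigcup_measurable _ (lebesgueType R n)) => i _.
exact: lebesgue_measurable_ball.
Qed.

Lemma compactly_included_bigcup (A O : set 'rV[R]_n) (B : nat -> set 'rV[R]_n) :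
  (forall i, open (B i)) -> O = \bigcup_i B i -> compactly_included A O ->
  exists k, A `<=` \bigcup_(i < k) B i.
Proof.
move=> oB OE [+ AO]; rewrite compact_cover => /(_ nat setT B).
case=> [//||D' _ AD]; first by move=> x /AO; rewrite OE.
(* One more than the largest index of a finite subcover, as the union runs over [i < k]. *)
exists (\max_(i <- finmap.enum_fset D') i).+1 => x /subset_closure /AD[i /= iD Bix].
exists i => //=; rewrite ltnS; exact: leq_bigmax_seq.
Qed.

End ball_cover.

(** * The s-perimeter as a perimeter of a measure on pairs *)

Section perimeter_of_density.
Context (R : realType) (n : nat) (s : R).
Local Open Scope ereal_scope.
Let T := lebesgueType R n.
Let mu := @lebesgue_rV R n.
Variable nu : {measure set (T * T) -> \bar R}.
Hypothesis nuE : forall A, nu A = \int[mu \x mu]_(z in A) kernel s z.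

Lemma interactionE (A B : set T) : measurable A -> measurable B ->
  interaction s A B = nu (A `*` B).
Proof.
move=> mA mB; rewrite nuE integral_setX//; first exact: measurable_kernel.
exact: kernel_ge0.
Qed.

Lemma s_perimeterE (V E : set T) : measurable V -> measurable E ->
  s_perimeter s E V = perimeter nu V E.
Proof.
move=> mV mE; have mCE := measurableC mE.
have mEV := measurableI _ _ mE mV; have mCEV := measurableI _ _ mCE mV.
have mED := measurableD mE mV; have mCED := measurableD mCE mV.
rewrite /s_perimeter !interactionE//.
have m1 := measurableX mEV mCEV; have m2 := measurableX mEV mCED.
have m3 := measurableX mED mCEV.
rewrite -measureU//; last by apply/seteqP; split => // -[x y] /=; tauto.
rewrite -measureU//; [|exact: measurableU|]; last first.
  by apply/seteqP; split => // -[x y] /=; tauto.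
congr (nu _); apply/seteqP; split => -[x y]; rewrite /crossing/=; first by tauto.
by have [] := pselect (V x); have [] := pselect (V y); tauto.
Qed.

(** Pairs with a component in a null set have [nu]-measure zero, and the crossing sets agree on all
    other pairs. *)
Lemma perimeter_ae (V E F : set T) : measurable V -> measurable E ->
  measurable F -> eq_set_ae E F -> perimeter nu V E = perimeter nu V F.
Proof.
move=> mV mE mF [N [mN N0 EFN]].
have EF x : ~ N x -> E x <-> F x.
  by move=> nNx; apply: contrapT => nEF; exact/nNx/EFN.
have [NT TN] : nu (N `*` setT) <= 0 /\ nu (setT `*` N) <= 0.
  have [e1 e2] := integral_null_setX (measurable_kernel s) mN N0.
  by rewrite !nuE; split; rewrite le_eqVlt; apply/orP; left; apply/eqP.
have mNN : measurable ((N `*` setT) `|` (setT `*` N) : set (T * T)).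
  by apply: measurableU; exact: measurableX.
have NN0 : nu ((N `*` setT) `|` (setT `*` N)) = 0.
  apply/eqP; rewrite -measure_le0; apply: (le_trans (measureU2 _ _ _)).
  - exact: measurableX.
  - exact: measurableX.
  - by rewrite -[leRHS]adde0; exact: leeD.
suff le_per G H : measurable G -> measurable H ->
    (forall x, ~ N x -> G x <-> H x) -> perimeter nu V G <= perimeter nu V H.
  by apply/eqP; rewrite eq_le !le_per// => x /EF; tauto.
move=> mG mH GH; rewrite -[leRHS]adde0 -NN0.
apply: le_trans (measureU2 _ _ _) => //; last exact: measurable_crossing.
rewrite le_measure ?inE//; first exact: measurable_crossing.
  by apply: measurableU => //; exact: measurable_crossing.
move=> [x y]; rewrite /crossing/=; have := GH x; have := GH y.
by have [] := pselect (N x); have [] := pselect (N y); tauto.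
Qed.

End perimeter_of_density.

(** * Exhaustion of [Omega] by finite unions of balls, and localization *)

Theorem corollary1p10 (R : realType) (n : nat) (s : R) (Omega E0 : set 'rV[R]_n) :
  0 < s < 1 -> open Omega -> lebesgue_measurable E0 ->
  exists E : set 'rV[R]_n,
    [/\ lebesgue_measurable E,
        locally_s_minimal s Omega E &
        eq_set_ae (E `\` Omega) (E0 `\` Omega)].
Proof.
move=> s01 oO mE0.
have [nu nuE] := density_measure (@lebesgue_rV R n)
  (measurable_kernel s) (@kernel_ge0 R n s).
have [c [r OE]] := open_countable_balls oO.
pose B i : set (lebesgueType R n) := ball (c i) (r i).
have mB i : measurable (B i) by exact: lebesgue_measurable_ball.
pose V k := \bigcup_(i < k) B i.
have mV k : measurable (V k) by exact: bigcup_measurable.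
have ndV : {homo V : i j / (i <= j)%N >-> i `<=` j}.
  by move=> i j ij x [l /= li Bl]; exists l => //=; exact: leq_trans ij.
have UV : \bigcup_k V k = Omega.
  rewrite OE; apply/seteqP; split => [x [k _ [i _ Bi]]|x [i _ Bi]].
    by exists i.
  by exists i.+1 => //; exists i => /=.
(* A pair entering [V k.+1] from outside enters [V k] or [B k], and starts outside both. *)
have Voo k : (nu (~` V k `*` V k) < +oo)%E.
  elim: k => [|k IH].
    rewrite (_ : _ `*` _ = set0) ?measure0//.
    by apply/seteqP; split => // -[x y] [_ []].
  apply: (@le_lt_trans _ _ (nu ((~` V k `*` V k) `|` (~` B k `*` B k)))).
    rewrite le_measure ?inE//.
    - by apply: measurableX => //; exact: measurableC.
    - by apply: measurableU; apply: measurableX => //; exact: measurableC.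
    - move=> [x y] [/= nVx [i /= ik Biy]].
      have nBx j : (j < k.+1)%N -> ~ B j x by move=> jk Bj; apply: nVx; exists j.
      move: ik; rewrite ltnS leq_eqVlt => /predU1P[ik|ik]; [right|left].
        by rewrite -ik; split => //; apply: nBx; rewrite ik.
      split; last by exists i.
      by move=> [j /= jk]; apply: nBx; exact: ltnW.
  apply: (le_lt_trans (measureU2 _ _ _)).
  - by apply: measurableX => //; exact: measurableC.
  - by apply: measurableX => //; exact: measurableC.
  - by rewrite lte_add_pinfty//; exact: density_ball_lty nuE s01 _ _.
have [E [mE EO minE]] := exists_minimal_exhaustion mV ndV Voo mE0.
rewrite UV in EO.
exists E; split => //; last first.
  by rewrite /eq_set_ae EO; apply: aeW.
move=> O' oO' O'O.
have mO' : measurable (O' : set (lebesgueType R n)) by exact: lebesgue_measurable_open.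
have [k O'V] : exists k, O' `<=` V k.
  apply: compactly_included_bigcup O'O => // i; exact: ball_open.
have Eoo := minimal_perimeter_lty (mV k) mE (Voo k) (minE k).
split.
  rewrite (s_perimeterE nuE mO' mE).
  have [t [t0 e _]] := perimeter_local nu mO' (mV k) mE mE O'V erefl.
  by apply: le_lt_trans Eoo; rewrite e leeDl.
move=> F mF FE; rewrite (s_perimeterE nuE mO' mE) (s_perimeterE nuE mO' mF).
(* [F] is changed on a null set, so as to agree with [E] exactly off [O']. *)
pose F' : set (lebesgueType R n) := (F `&` O') `|` (E `\` O').
have mF' : measurable F'.
  by apply: measurableU; [exact: measurableI|exact: measurableD].
have F'E : F' `\` O' = E `\` O' by apply/seteqP; split => x; rewrite /F'/=; tauto.
rewrite (perimeter_ae nuE mO' mF mF'); last first.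
  move: FE => [N [mN N0 FEN]]; exists N; split => // x nFF'; apply: FEN => /= FEx.
  by apply: nFF'; rewrite /F'/=; have [] := pselect (O' x); tauto.
have [t [t0 e1 e2]] := perimeter_local nu mO' (mV k) mF' mE O'V F'E.
(* The part [t] common to both perimeters in [V k] is finite, so minimality in [V k] descends to
   [O'] by cancellation. *)
have tfin : t \is a fin_num.
  by rewrite ge0_fin_numE//; apply: le_lt_trans Eoo; rewrite e2 leeDr.
rewrite -(leeD2rE _ _ tfin) -e1 -e2; apply: minE => //.
by apply/seteqP; split => x [H nV]; split => //;
  have nO' : ~ O' x by [move=> /O'V]; move/seteqP: F'E => [/(_ x) + /(_ x)] => /=; tauto.
Qed.
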